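(* Let $T$ be a finite tree with at least two vertices. Then $$\operatorname{stack}(T)=\operatorname{estim}(T).$$
   Context: Graphs are finite, simple and undirected; a tree is a nonempty connected acyclic graph; $\mathbb N$ includes $0$. Pebbling. A configuration on $T$ is a function $C:V(T)\to\mathbb N$; its mass is $|C|=\sum_v C(v)$ and its support is $\{v:C(v)>0\}$. A move $u\to v$ is legal when $u,v$ are adjacent and $C(u)\ge 2$; it replaces $C(u)$ by $C(u)-2$ and $C(v)$ by $C(v)+1$. A configuration $C'$ is reachable from $C$ if it is obtained by a finite (possibly empty) sequence of legal moves. A configuration is stacked at $r$ when its support is exactly $\{r\}$ (so the zero configuration is not stacked). $C$ is stackable if, for some vertex $r$, a configuration stacked at $r$ is reachable from $C$. The stacking number $\operatorname{stack}(T)$ is the least integer $t\ge2$ such that every configuration of mass exactly $t$ on $T$ is stackable (the existence of such a $t$ is part of what is asserted). Estimator. With $d_T$ the graph distance and $r\in V(T)$, put $$\ell_T(r)=|\{v\ne r:\deg_T(v)=1\}|,\qquad \sigma_T(r)=1+\sum_{\substack{v\in V(T)\\ v=r\text{ or }\deg_T(v)>1}}\deg_T(v)\,2^{d_T(r,v)},$$ $$E_T(r)=\sigma_T(r)+\ell_T(r),\qquad \operatorname{estim}(T)=\max_{r\in V(T)}E_T(r).$$ *)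

(* Defs.v *)
From mathcomp Require Import all_boot.

Set Implicit Arguments.
Unset Strict Implicit.
Unset Printing Implicit Defensive.

(* A graph on the vertex set [T] is given by its adjacency relation. *)
Section Graph.

Variables (T : finType) (e : rel T).

Definition simple_graph : Prop := symmetric e /\ irreflexive e.

Definition connected_graph : Prop := forall x y : T, connect e x y.

(* In a simple graph every edge {x, y} gives the closed walk [:: x; y]; graph
   cycles are the duplicate-free closed walks with at least 3 vertices. *)
Definition acyclic_graph : Prop :=
  forall c : seq T, ucycle e c -> size c < 3.

Definition is_tree : Prop :=
  [/\ simple_graph, 0 < #|T|, connected_graph & acyclic_graph].

Definition deg (v : T) : nat := #|[set w | e v w]|.

(* The least number of edges of a walk from [x] to [y].  A shortest walk has
   fewer than [#|T|] edges; the value is the junk [#|T|] if there is none. *)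
Definition gdist (x y : T) : nat :=
  find (fun n => [exists p : n.-tuple T, path e x p && (last x p == y)])
       (iota 0 #|T|).

Definition config := {ffun T -> nat}.

Definition mass (C : config) : nat := \sum_v C v.

Definition support (C : config) : {set T} := [set v | 0 < C v].

Definition legal_move (C : config) (u v : T) : bool := e u v && (2 <= C u).

Definition move (C : config) (u v : T) : config :=
  [ffun w => if w == u then C w - 2 else if w == v then C w + 1 else C w].

Inductive reachable (C : config) : config -> Prop :=
| reachable_refl : reachable C C
| reachable_move (D : config) (u v : T) :
    reachable C D -> legal_move D u v -> reachable C (move D u v).

Definition stacked_at (C : config) (r : T) : Prop := support C = [set r].

Definition stackable (C : config) : Prop :=
  exists r D, reachable C D /\ stacked_at D r.

Definition all_stackable (t : nat) : Prop :=
  forall C : config, mass C = t -> stackable C.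

(* [is_stack s] says that the stacking number exists and is equal to [s]. *)
Definition is_stack (s : nat) : Prop :=
  [/\ 2 <= s, all_stackable s &
      forall t, 2 <= t -> all_stackable t -> s <= t].

Definition ell (r : T) : nat := #|[set v | (v != r) && (deg v == 1)]|.

Definition sigma (r : T) : nat :=
  1 + \sum_(v | (v == r) || (1 < deg v)) deg v * 2 ^ gdist r v.

Definition estimE (r : T) : nat := sigma r + ell r.

Definition estim : nat := \max_r estimE r.

End Graph.

(* Main.v *)
Require Import Defs.
From mathcomp Require Import all_boot.
From mathcomp Require Import all_algebra zify.

Set Implicit Arguments.
Unset Strict Implicit.
Unset Printing Implicit Defensive.

(** Since moves lower the mass, stackability of all configurations of mass [n]
    passes to mass [n + 1] ([all_stackableS]).  It therefore suffices to stack
    every configuration of mass [estim e] and to find, for every [r], one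
    configuration of mass [estimE e r - 1] that cannot be stacked.

    Lower bound.  Put one pebble on each leaf other than [r], and on [r] the
    sum of [deg v * 2 ^ d(r, v)] over [r] and the non-leaves.  Weigh a pebble
    at [v] by [2 ^ d(r, v)].  A move away from [r] keeps the total weight, and
    a move towards [r] along an edge whose near end is [p] lowers it by
    [3 * 2 ^ d(r, p)].  At the start the weight is exactly the sum of
    [3 * 2 ^ d(r, p)] over all edges, and behind every edge there are pebbles.
    Emptying what lies behind an edge takes a move towards [r] along it, so
    that the weight never exceeds the sum of [3 * 2 ^ d(r, p)] over the edges
    with pebbles behind them ([budget_move]).  If all pebbles ended at [q],
    only the edges between [r] and [q] would count, so the weight would be less
    than [3 * 2 ^ d(r, q)]: fewer than three pebbles, although the weight stays
    divisible by 3.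

    Upper bound.  Root the tree at any vertex [s] that carries a pebble.  Going
    up from the leaves, compute for each [v] the number of pebbles that can be
    gathered at [v] out of the branch of [v] ([surplus]); a child of surplus
    [m] changes the number at its parent by [net_up m], a function of slope 2
    where pebbles must be sent down ([m <= 0]) and of slope 1/2 where they can
    be sent up.  If the surplus of [s] is positive, all pebbles can be stacked
    at [s] ([surplus_stackable]).  Otherwise, unfolding the recursion with the
    product of the slopes as multiplier of each vertex gives potentials
    [2 ^ k v], whose exponents differ by exactly one along each edge, such that
    the total potential of the pebbles is at most the sum over the edges
    [{u, v}] that have pebbles below them of [2 ^ k u + 2 ^ k v]
    ([surplus_certificate]).  Here the direction of the slopes has disappeared.
    Dividing by the least potential, attained at [r], each vertex [v] has
    relative potential between 1 and [2 ^ d(r, v)], and grouping the sum by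
    vertices turns [2 ^ k v] into [deg v] terms.  On a leaf other than [r] its
    own term is cancelled by one of its pebbles.  This bounds the mass by
    [estimE e r - 1] ([mass_le_estimate]). *)

(** * Distances and the rooting of a tree *)

Section Dist.
Variables (T : finType) (e : rel T).
Hypothesis conn_e : connected_graph e.

Lemma has_walk x y :
  has (fun n => [exists p : n.-tuple T, path e x p && (last x p == y)])
    (iota 0 #|T|).
Proof.
have [p ep] := connectP (conn_e x y).
case: (shortenP ep) => q eq uq _ lq.
apply/hasP; exists (size q).
  rewrite mem_iota /= add0n; have := card_uniqP uq => /= <-.
  exact: max_card.
by apply/existsP; exists (in_tuple q); rewrite /= eq -lq eqxx.
Qed.

Lemma gdist_lt x y : gdist e x y < #|T|.
Proof. by rewrite -[X in _ < X](size_iota 0) -has_find has_walk. Qed.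

Lemma gdistP x y :
  exists2 p : seq T, path e x p /\ last x p = y & size p = gdist e x y.
Proof.
have := nth_find 0 (has_walk x y); rewrite nth_iota ?gdist_lt // add0n.
case/existsP=> p /andP[ep /eqP lp]; exists (val p) => //.
exact: size_tuple.
Qed.

Lemma gdist_le x p : path e x p -> gdist e x (last x p) <= size p.
Proof.
move=> ep; rewrite leqNgt; apply/negP => lt.
have := before_find 0 lt.
rewrite nth_iota ?add0n; last exact: ltn_trans lt (gdist_lt _ _).
by move/negbT/existsPn/(_ (in_tuple p)); rewrite /= ep eqxx.
Qed.

Lemma gdist0 x : gdist e x x = 0.
Proof. by apply/eqP; rewrite -leqn0 (@gdist_le x [::]). Qed.

Lemma gdist_edge x y z : e y z -> gdist e x z <= (gdist e x y).+1.
Proof.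
move=> eyz; have [p [ep lp] <-] := gdistP x y.
have := @gdist_le x (rcons p z).
by rewrite rcons_path ep lp last_rcons size_rcons; apply.
Qed.

Lemma gdist_pred x y : y != x ->
  exists2 z, e z y & gdist e x y = (gdist e x z).+1.
Proof.
move=> yx; have [p [ep lp] sp] := gdistP x y.
case/lastP: p ep lp sp => [|p z].
  by move=> _ /= xy; rewrite xy eqxx in yx.
rewrite rcons_path last_rcons size_rcons => /andP[ep ez] zy sp.
rewrite zy in ez; exists (last x p) => //; apply/eqP.
by rewrite eqn_leq gdist_edge //= -sp ltnS gdist_le.
Qed.

End Dist.

(** All that is used of a tree with root [s]: a parent function, a depth, and
    the fact that every edge joins a vertex to its parent. *)
Record rooted (T : finType) (e : rel T) (s : T) (par : T -> T) (dep : T -> nat)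
  : Prop := Rooted {
  par_root : par s = s;
  dep_root : dep s = 0;
  par_edge : forall v, v != s -> e v (par v);
  dep_par : forall v, v != s -> dep v = (dep (par v)).+1;
  edge_par : forall x y, e x y -> (x != s /\ par x = y) \/ (y != s /\ par y = x)
}.

Lemma tree_rooted (T : finType) (e : rel T) (s : T) :
  is_tree e -> exists par, rooted e s par (gdist e s).
Proof.
case=> -[sym_e irr_e] _ conn_e acyc_e; set d := gdist e s.
pose par v := odflt v [pick u | (v != s) && e u v && (d v == (d u).+1)].
have parP v : v != s -> e (par v) v /\ d v = (d (par v)).+1.
  rewrite /par => vs; case: pickP => [u /andP[/andP[_ euv /eqP ->]] //|none].
  have [z ezv dz] := gdist_pred conn_e vs.
  by have := none z; rewrite vs ezv -/d /d dz eqxx.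
have par_s : par s = s by rewrite /par; case: pickP => // u; rewrite eqxx.
have ds : d s = 0 by exact: gdist0.
exists par; split=> //.
- by move=> v /parP[]; rewrite sym_e.
- by move=> v /parP[].
(* If [x] were a neighbour of [y] no farther than [y] from the root and other
   than the parent of [y], then both would be linked to the root while avoiding
   [y], which would close a cycle through [y]. *)
have up x y : e x y -> d x <= d y -> y != s /\ par y = x.
  move=> exy dxy.
  have ys : y != s.
    apply/eqP=> ys; move: dxy; rewrite ys ds leqn0 => /eqP dx.
    have xs : x = s.
      by apply/eqP; apply: contraTT isT => /parP[_]; rewrite dx.
    by rewrite xs ys irr_e in exy.
  split=> //; apply/eqP; apply: contraT => pyx; have [epy dpy] := parP y ys.
  pose f u v := [&& e u v, u != y & v != y].
  have f_sym : symmetric f.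
    by move=> u v; rewrite /f sym_e [(u != y) && _]andbC.
  have to_s n a : d a = n -> d a <= d y -> a != y -> connect f a s.
    elim: n a => [|n IH] a da day ay.
      have [->|/parP[_]] := eqVneq a s; first exact: connect0.
      by rewrite da.
    have as_ : a != s by apply/eqP=> as_; move: da; rewrite as_ ds.
    have [ea dpa] := parP a as_.
    have lt : d (par a) < d y by rewrite -dpa.
    have pay : par a != y by apply/eqP=> pay; rewrite pay ltnn in lt.
    apply: connect_trans (connect1 _) (IH (par a) _ (ltnW lt) pay).
      by rewrite /f sym_e ea ay.
    by move: dpa; rewrite da => -[].
  have xy : x != y by apply: contraTneq exy => ->; rewrite irr_e.
  have pyy : par y != y.
    by apply: contraTneq (leqnn (d y)) => pyy; rewrite {1}dpy pyy ltnn.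
  have : connect f x (par y).
    apply: connect_trans (to_s _ _ erefl dxy xy) _.
    by rewrite (sym_connect_sym f_sym) (to_s _ _ erefl) // dpy leqnSn.
  case/connectP=> p fp lp; case: (shortenP fp) lp => q fq uq _ lq.
  have yq : y \notin x :: q.
    rewrite inE negb_or eq_sym xy /=.
    elim: q x {exy dxy pyx xy uq fp lq} fq => //= z q IH x.
    case/andP=> /and3P[_ _ zy] fq.
    by rewrite inE negb_or eq_sym zy (IH z).
  have eq : path e x q by apply: sub_path fq => u v /and3P[].
  have: size (y :: x :: q) < 3.
    apply: acyc_e; rewrite /ucycle /= rcons_path -lq epy sym_e exy eq /=.
    by rewrite yq; move: uq => /= ->.
  by case: q lq {fq uq yq eq} => //= pyx'; rewrite pyx' eqxx in pyx.
move=> x y exy; case: (leqP (d x) (d y)) => [le|/ltnW le].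
  by right; apply: up.
by left; apply: up => //; rewrite sym_e.
Qed.

Lemma leq_sum_subset (I : finType) (P Q : pred I) (F : I -> nat) :
  (forall i, P i -> Q i) -> \sum_(i | P i) F i <= \sum_(i | Q i) F i.
Proof.
move=> PQ; rewrite big_mkcond [leqRHS]big_mkcond; apply: leq_sum => i _.
by case: ifP => [/PQ ->|].
Qed.

(** * Branches of a rooted tree *)

Section Rooted.
Variables (T : finType) (e : rel T) (s : T) (par : T -> T) (dep : T -> nat).
Hypothesis root_e : rooted e s par dep.
Hypothesis sym_e : symmetric e.

(** [branch u w] says that [w] is [u] or a descendant of [u]. *)
Definition branch (u w : T) : bool := fconnect par w u.
Definition child (v u : T) : bool := (u != s) && (par u == v).
Definition nonempty (X : config T) (u : T) : bool :=
  [exists w, (0 < X w) && branch u w].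

Lemma dep_pred v : dep (par v) = (dep v).-1.
Proof.
have [->|/(dep_par root_e)->//] := eqVneq v s.
by rewrite (par_root root_e) (dep_root root_e).
Qed.

Lemma dep_iter n v : dep (iter n par v) = dep v - n.
Proof. by elim: n => [|n IH]; rewrite ?subn0 //= dep_pred IH subnS. Qed.

Lemma dep_eq0 v : (dep v == 0) = (v == s).
Proof.
have [->|/(dep_par root_e)->//] := eqVneq v s.
by rewrite (dep_root root_e) eqxx.
Qed.

Lemma child_dep v u : child v u -> dep u = (dep v).+1.
Proof. by case/andP=> /(dep_par root_e) -> /eqP ->. Qed.

Lemma child_edge v u : child v u -> e u v.
Proof. by case/andP=> us /eqP <-; apply: (par_edge root_e us). Qed.

Lemma edge_neq x y : e x y -> x != y.
Proof.
move=> exy; apply: contraTneq (leqnn (dep x)) => xy; rewrite -xy in exy.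
by case: (edge_par root_e exy) => -[/(dep_par root_e) dx px];
   rewrite {1}dx px ltnn.
Qed.

Lemma branch_refl u : branch u u.
Proof. exact: connect0. Qed.

Lemma branch_trans v u w : branch u v -> branch v w -> branch u w.
Proof. by move=> uv vw; apply: connect_trans vw uv. Qed.

Lemma branch_root w : branch s w.
Proof.
suff <- : iter (dep w) par w = s by apply: fconnect_iter.
by apply/eqP; rewrite -dep_eq0 dep_iter subnn.
Qed.

Lemma child_branch v u : child v u -> branch v u.
Proof. by case/andP=> _ /eqP <-; apply: fconnect1. Qed.

Lemma branch_leq u w : branch u w -> dep u <= dep w.
Proof. by move=> /iter_findex <-; rewrite dep_iter leq_subr. Qed.

Lemma iter_branch u w : branch u w -> iter (dep w - dep u) par w = u.
Proof.
move=> /iter_findex; set n := findex _ _ _ => wu; rewrite -wu dep_iter.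
have [le|lt] := leqP n (dep w); first by rewrite subKn.
move: (ltnW lt); rewrite -subn_eq0 => /eqP d0.
have us : u = s by apply/eqP; rewrite -dep_eq0 -wu dep_iter d0.
rewrite d0 subn0 wu us; apply/eqP.
by rewrite -dep_eq0 dep_iter subnn.
Qed.

Lemma branch_par u w :
  branch u w = (w == u) || (w != s) && branch u (par w).
Proof.
apply/idP/idP.
  move/iter_findex; case: (findex _ _ _) => [|n] => [<-|].
    by rewrite eqxx.
  rewrite iterSr; have [->|ws <-] := eqVneq w s.
    rewrite (par_root root_e) iter_fix ?(par_root root_e) // => ->.
    by rewrite eqxx.
  by rewrite /branch fconnect_iter orbT.
case/orP=> [/eqP->|/andP[_]]; first exact: branch_refl.
by move=> uw; apply: connect_trans (fconnect1 _ _) uw.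
Qed.

Lemma branch_child v w :
  branch v w -> w != v -> exists2 u, child v u & branch u w.
Proof.
move=> vw wv; have := iter_branch vw.
case E: (dep w - dep v) => [|n] /= iv; first by rewrite iv eqxx in wv.
exists (iter n par w); last exact: fconnect_iter.
rewrite /child iv eqxx andbT -dep_eq0 dep_iter -lt0n subn_gt0.
by apply: leq_trans (leq_subr (dep v) _); rewrite E.
Qed.

Lemma branch_child_inj v u1 u2 w :
  child v u1 -> child v u2 -> branch u1 w -> branch u2 w -> u1 = u2.
Proof.
move=> /child_dep d1 /child_dep d2 /iter_branch <- /iter_branch <-.
by rewrite d1 d2.
Qed.

Lemma child_notin_branch v u : child v u -> ~~ branch u v.
Proof.
by move=> /child_dep du; apply/negP=> /branch_leq; rewrite du ltnn.
Qed.

Lemma deg_children v : deg e v = #|[set u | child v u]| + (v != s).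
Proof.
rewrite /deg; have -> : [set w | e v w] =
    [set u | child v u] :|: (if v != s then [set par v] else set0).
  apply/setP=> w; rewrite !inE; apply/idP/idP.
    by case/(edge_par root_e) => -[ns <-]; rewrite /child ns ?inE eqxx ?orbT.
  case/orP=> [/child_edge|]; first by rewrite sym_e.
  by case: ifP => vs; rewrite inE // => /eqP ->; apply: (par_edge root_e vs).
rewrite cardsU; case: ifP => vs;
  rewrite ?cards1 ?cards0 ?setI0 ?cards0 ?subn0 //.
rewrite (_ : _ :&: _ = set0) ?cards0 ?subn0 //.
apply/setP=> w; rewrite !inE; apply/negbTE/negP=> /andP[/child_dep dw /eqP wv].
by move: dw; rewrite wv dep_pred; lia.
Qed.

(** A deepest vertex of the branch of [u] has no child, hence is a leaf. *)
Lemma branch_leaf u : (forall v, dep v < #|T|) -> u != s ->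
  exists2 l, branch u l & (l != s) && (deg e l == 1).
Proof.
move=> dlt; have [n] := ubnP (#|T| - dep u); elim: n u => // n IH u lt us.
have [d1|] := boolP (deg e u == 1).
  by exists u; [exact: branch_refl|rewrite us].
rewrite deg_children us addn1 eqSS cards_eq0 => /set0Pn[c]; rewrite inE => uc.
have [|//|l cl lP] := IH c; last 1 first.
- by exists l => //; apply: branch_trans (child_branch uc) cl.
- apply: leq_trans _ (_ : #|T| - dep u <= n); last by rewrite -ltnS.
  by rewrite (child_dep uc) ltn_sub2l.
- by case/andP: uc.
Qed.

Lemma big_edges (R : Type) (idx : R) (op : Monoid.com_law idx)
    (F : T -> T -> R) :
  \big[op/idx]_(u | u != s) F u (par u) =
  \big[op/idx]_v \big[op/idx]_(u | child v u) F u v.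
Proof.
rewrite (partition_big par xpredT) //=; apply: eq_bigr => v _.
by apply: eq_bigr => u /andP[_ /eqP ->].
Qed.

Lemma sum_par (F : T -> nat) :
  \sum_(u | u != s) F (par u) = \sum_v #|[set u | child v u]| * F v.
Proof.
rewrite (big_edges _ (fun _ => F)); apply: eq_bigr => v _.
by rewrite sum_nat_const cardsE.
Qed.

(** The handshake identity, with a weight on the vertices. *)
Lemma sum_deg (F : T -> nat) :
  \sum_v deg e v * F v = \sum_(u | u != s) (F u + F (par u)).
Proof.
rewrite [RHS]big_split /= sum_par [X in _ = X + _]big_mkcond -big_split /=.
apply: eq_bigr => v _; rewrite deg_children mulnDl addnC.
by case: (v != s); rewrite ?mul1n.
Qed.

(** * Weights: why some configurations cannot be stacked *)

Definition weight (X : config T) : nat := \sum_v X v * 2 ^ dep v.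

(** The edge from [u] to its parent counts as long as there are pebbles behind
    it; three times this sum bounds the weight. *)
Definition budget (X : config T) : nat :=
  \sum_(u | (u != s) && nonempty X u) 2 ^ dep (par u).

(** The edges above [q] contribute [1 + 2 + ... + 2 ^ (dep q - 1)]. *)
Lemma budget_stacked q :
  \sum_(u | (u != s) && branch u q) 2 ^ dep (par u) < 2 ^ dep q.
Proof.
move dq: (dep q) => n; rewrite -dq.
elim: n q dq => [|n IH] q dq.
  rewrite big_pred0 ?expn_gt0 // => u; apply/negP=> /andP[us /branch_leq].
  by rewrite dq leqn0 dep_eq0 (negbTE us).
have qs : q != s by rewrite -dep_eq0 dq.
have dp : dep (par q) = n by rewrite dep_pred dq.
rewrite (bigD1 q) /= ?qs ?branch_refl // dp dq expnS mul2n -addnn -addnS.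
rewrite leq_add2l -{1}dp; apply: leq_ltn_trans (IH _ dp).
apply: leq_sum_subset => u /andP[/andP[-> uq] nuq] /=.
by move: uq; rewrite branch_par eq_sym (negbTE nuq) qs.
Qed.

Lemma sum_move (X : config T) u v (F : T -> nat) : u != v -> 2 <= X u ->
  \sum_w move X u v w * F w + 2 * F u = \sum_w X w * F w + F v.
Proof.
move=> uv X2; rewrite (bigD1 u) //= [in RHS](bigD1 u) //=.
rewrite (bigD1 v) 1?eq_sym //= [in RHS](bigD1 v) 1?eq_sym //= !ffunE !eqxx.
rewrite [v == u]eq_sym (negbTE uv).
rewrite [X in _ + (_ + X) + _](eq_bigr (fun w => X w * F w)); last first.
  by move=> w /andP[/negbTE wu /negbTE wv]; rewrite ffunE wu wv.
rewrite mulnBl mulnDl mul1n.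
have : 2 * F u <= X u * F u by rewrite leq_mul2r X2 orbT.
set a := X u * F u; set b := X v * F v; set c := \sum_(_ | _) _; lia.
Qed.

(** Every branch that contains [u], other than the branch of [u] itself when [v]
    is the parent of [u], also contains [v]. *)
Lemma nonempty_move X u v x : legal_move e X u v -> nonempty X x ->
  nonempty (move X u v) x || (x == u).
Proof.
case/andP=> euv X2 /existsP[w /andP[Xw xw]].
have uv := edge_neq euv.
have Yv : 0 < move X u v v.
  by rewrite ffunE eqxx [v == u]eq_sym (negbTE uv) addn1.
have [wu|wu] := eqVneq w u; last first.
  apply/orP; left; apply/existsP; exists w; rewrite xw andbT ffunE (negbTE wu).
  by case: ifP; rewrite ?addn1.
rewrite {}wu in Xw xw.
case: (edge_par root_e euv) => -[ns pv].
  move: xw; rewrite branch_par pv eq_sym.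
  case: (x == u) => /=; first by rewrite orbT.
  by case/andP=> _ xv; rewrite orbF; apply/existsP; exists v; rewrite Yv.
apply/orP; left; apply/existsP; exists v; rewrite Yv.
by apply: branch_trans xw _; apply: child_branch; rewrite /child ns pv eqxx.
Qed.

(** A move towards the root pays [3 * 2 ^ dep v] of weight, which covers the one
    term that it may remove from the budget; a move away from the root keeps
    the weight and removes no term. *)
Lemma budget_move X u v : legal_move e X u v ->
  3 %| weight X -> weight X <= 3 * budget X ->
  3 %| weight (move X u v) /\ weight (move X u v) <= 3 * budget (move X u v).
Proof.
move=> uvX d3 le; have [euv X2] := andP uvX; have uv := edge_neq euv.
have := sum_move (fun w => 2 ^ dep w) uv X2; rewrite -!/(weight _) => E.
have NE := nonempty_move uvX.
case: (edge_par root_e euv) => -[ns pv]; move: (dep_par root_e ns) => dE.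
- have bE : budget X <= 2 ^ dep v + budget (move X u v).
    have -> : 2 ^ dep v = \sum_(x | x == u) 2 ^ dep (par x).
      by rewrite big_pred1_eq pv.
    rewrite /budget big_mkcond [X in _ <= X + _]big_mkcond.
    rewrite [X in _ <= _ + X]big_mkcond.
    rewrite -big_split /=; apply: leq_sum => x _.
    case: ifP => // /andP[-> /NE] /=.
    by case/orP=> [->|->]; rewrite ?leq_addl ?leq_addr.
  move: E; rewrite dE pv expnS; set a := 2 ^ _ in bE *; move: d3 le bE.
  by rewrite !/dvdn; lia.
- have bE : budget X <= budget (move X u v).
    apply: leq_sum_subset => x /andP[xs xX]; rewrite xs /=.
    have := NE _ xX; case/orP=> // /eqP xu; apply/existsP; exists v.
    rewrite ffunE eqxx [v == u]eq_sym (negbTE uv) addn1 /=.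
    by rewrite xu; apply: child_branch; rewrite /child ns pv eqxx.
  move: E; rewrite dE pv expnS; move: d3 le bE; lia.
Qed.

(** Once everything is at [q], fewer than three pebbles are left there, while
    their weight, and hence their number, is a multiple of 3. *)
Lemma budget_unstackable X : 3 %| weight X -> weight X <= 3 * budget X ->
  ~ stackable e X.
Proof.
move=> d3 le [q [Y [XY Yq]]].
have {X XY d3 le} [d3 le] : 3 %| weight Y /\ weight Y <= 3 * budget Y.
  by elim: XY => // D u v _ [d l] uv; apply: budget_move.
have Y0 w : (0 < Y w) = (w == q).
  by have := congr1 (fun A : {set T} => w \in A) Yq; rewrite !inE.
have wE : weight Y = Y q * 2 ^ dep q.
  rewrite /weight (bigD1 q) //= big1 ?addn0 // => w wq.
  by have := Y0 w; rewrite (negbTE wq); case: (Y w).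
have bE : budget Y < 2 ^ dep q.
  apply: leq_ltn_trans (budget_stacked q); apply: leq_sum_subset => u.
  by case/andP=> -> /existsP[w]; rewrite Y0 => /andP[/eqP ->].
move: le; rewrite wE => le.
have : Y q * 2 ^ dep q < 3 * 2 ^ dep q.
  by apply: leq_ltn_trans le _; rewrite ltn_pmul2l.
rewrite ltn_pmul2r ?expn_gt0 // => lt.
move: d3; rewrite wE Gauss_dvdl ?coprimeXr // => /dvdn_leq.
by rewrite Y0 eqxx leqNgt lt => /(_ isT).
Qed.

(** * Gathering the pebbles of a branch *)

Implicit Types X Y Z : config T.

Definition transfer (X : config T) (u v : T) (k : nat) : config T :=
  [ffun w => if w == u then X w - 2 * k else if w == v then X w + k else X w].

Lemma reachable_trans (X Y Z : config T) :
  reachable e X Y -> reachable e Y Z -> reachable e X Z.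
Proof. by move=> XY; elim=> // D u v _ XD; apply: reachable_move XD. Qed.

Lemma reachable_transfer X u v k : e u v -> 2 * k <= X u ->
  reachable e X (transfer X u v k).
Proof.
move=> euv; have uv := edge_neq euv; elim: k => [|k IH] le.
  rewrite (_ : transfer _ _ _ _ = X); first exact: reachable_refl.
  by apply/ffunP=> w; rewrite ffunE muln0 subn0 addn0; do 2?case: eqP => [->|_].
have {}IH := IH (leq_trans (leq_mul (leqnn 2) (leqnSn k)) le).
have l : legal_move e (transfer X u v k) u v.
  by rewrite /legal_move euv ffunE eqxx; lia.
rewrite (_ : transfer _ _ _ _ = move (transfer X u v k) u v).
  exact: reachable_move IH l.
apply/ffunP=> w; rewrite !ffunE.
by do 2?case: eqP => _; lia.
Qed.

Import GRing.Theory Num.Theory.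
Local Open Scope ring_scope.

(** The change at a vertex when a child at which [m] pebbles can be gathered is
    cleared.  If [m] is positive and even, [m / 2] pebbles go up.  If [m] is odd,
    a last pebble remains at the child; sending it a companion and moving the
    pair up costs one pebble more.  If [m <= 0], the parent first sends [2 - m]
    pebbles, at the cost of [2 * (2 - m)], so that exactly two can be gathered,
    and gets one back. *)
Definition net_up (m : int) : int :=
  if m is Posz n.+1 then (n.+1)./2%:Z - (odd n.+1 : nat)%:Z else m *+ 2 - 3.

(** The first argument bounds the height of the branch that is explored; any
    bound that is at least the height gives the same value. *)
Fixpoint surplus_rec (n : nat) (X : config T) (v : T) : int :=
  (X v)%:Z +
  if n is n'.+1 then
    \sum_(u | child v u && nonempty X u) net_up (surplus_rec n' X u)
  else 0.

Definition surplus (X : config T) (v : T) : int := surplus_rec #|T| X v.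

Hypothesis dep_lt : forall v, (dep v < #|T|)%N.

Lemma surplus_rec_stable n X v : (#|T| <= n + dep v)%N ->
  surplus_rec n.+1 X v = surplus_rec n X v.
Proof.
elim: n v => [|n IH] v le.
  by have := dep_lt v; rewrite ltnNge -[dep v]add0n le.
rewrite [LHS]/= [RHS]/=; congr (_ + _); apply: eq_bigr => u /andP[vu _].
by rewrite -IH // (child_dep vu) addnS -addSn.
Qed.

Lemma surplusE X v : surplus X v =
  (X v)%:Z + \sum_(u | child v u && nonempty X u) net_up (surplus X u).
Proof. by rewrite -[LHS]surplus_rec_stable ?leq_addr. Qed.

Lemma nonempty_local X Y v : (forall w, branch v w -> X w = Y w) ->
  nonempty X v = nonempty Y v.
Proof.
move=> XY; apply/existsP/existsP => -[w /andP[Zw vw]]; exists w;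
by move: Zw; rewrite (XY _ vw) vw => ->.
Qed.

Lemma surplus_local X Y v : (forall w, branch v w -> X w = Y w) ->
  surplus X v = surplus Y v.
Proof.
rewrite /surplus; elim: #|T| v => [|n IH] v XY /=.
  by rewrite XY ?branch_refl.
rewrite XY ?branch_refl //; congr (_ + _).
have XYu u : child v u -> forall w, branch u w -> X w = Y w.
  by move=> vu w uw; apply: XY; apply: branch_trans (child_branch vu) uw.
rewrite big_mkcondr [RHS]big_mkcondr; apply: eq_bigr => u vu.
by rewrite (nonempty_local (XYu u vu)) (IH u (XYu u vu)).
Qed.

Lemma surplus_update X Y v :
  (forall w, branch v w -> w != v -> X w = Y w) ->
  surplus Y v = surplus X v + (Y v)%:Z - (X v)%:Z.
Proof.
move=> XY; rewrite !surplusE.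
have XYu u : child v u -> forall w, branch u w -> X w = Y w.
  move=> vu w uw; apply: XY; first exact: branch_trans (child_branch vu) uw.
  by apply: contraTneq uw => ->; apply: child_notin_branch vu.
have -> : \sum_(u | child v u && nonempty X u) net_up (surplus X u) =
          \sum_(u | child v u && nonempty Y u) net_up (surplus Y u).
  rewrite big_mkcondr [RHS]big_mkcondr; apply: eq_bigr => u vu.
  by rewrite (nonempty_local (XYu u vu)) (surplus_local (XYu u vu)).
set S := \sum_(_ | _) _; lia.
Qed.

(** The property is stated for all configurations at once because a branch is
    gathered after moves elsewhere, and sometimes with pebbles sent into it. *)
Definition gathers (v : T) : Prop := forall X, 1 <= surplus X v ->
  exists Y, [/\ reachable e X Y, (Y v)%:Z = surplus X v,
    forall w, branch v w -> w != v -> Y w = 0%N &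
    forall w, ~~ branch v w -> Y w = X w].

(** The child [u] can be cleared as soon as this leaves a pebble on [v]: the
    bound [1 <= X v + net_up _] is exactly what makes the moves from [v] to [u]
    legal. *)
Lemma clear_branch v u X : child v u -> gathers u ->
  1 <= (X v)%:Z + net_up (surplus X u) ->
  exists Y, [/\ reachable e X Y, (Y v)%:Z = (X v)%:Z + net_up (surplus X u),
    forall w, branch u w -> Y w = 0%N &
    forall w, w != v -> ~~ branch u w -> Y w = X w].
Proof.
move=> vu gu Xv1.
have euv := child_edge vu; have evu : e v u by rewrite sym_e.
have uv := edge_neq euv; have vu' := edge_neq evu.
have nuv := child_notin_branch vu.
have uu := branch_refl u.
have [m0|m1] : surplus X u <= 0 \/ 1 <= surplus X u by lia.
  (* Here [v] sends just enough for exactly two pebbles to be gathered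
     at [u]. *)
  pose j := `|2 - surplus X u|%N.
  have jE : j%:Z = 2 - surplus X u by rewrite /j; lia.
  have net_upE : net_up (surplus X u) = surplus X u *+ 2 - 3.
    by case: (surplus X u) m0 => [[]|].
  pose X1 := transfer X v u j.
  have XX1 : reachable e X X1.
    by apply: reachable_transfer => //; rewrite net_upE in Xv1; lia.
  have X1u : X1 u = (X u + j)%N by rewrite ffunE eqxx (negbTE uv).
  have X1v : X1 v = (X v - 2 * j)%N by rewrite ffunE eqxx.
  have X1o w : w != u -> w != v -> X1 w = X w.
    by move=> wu wv; rewrite ffunE (negbTE wu) (negbTE wv).
  have X1s : surplus X1 u = 2.
    rewrite (surplus_update (X := X)) ?X1u; first lia.
    by move=> w uw wu; rewrite X1o //; apply: contraTneq uw => ->.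
  have [|Y [XY Yu Yb Yo]] := gu X1; first by rewrite X1s.
  have {}Yu : Y u = 2%N by apply/eqP; rewrite -eqz_nat Yu X1s.
  exists (move Y u v); split.
  - apply: reachable_move; first exact: reachable_trans XX1 XY.
    by rewrite /legal_move euv Yu.
  - rewrite net_upE in Xv1 *.
    by rewrite ffunE (negbTE vu') eqxx Yo // X1v; lia.
  - move=> w uw; rewrite ffunE; have [->|wu] := eqVneq w u; first by rewrite Yu.
    rewrite Yb //; case: eqP => // wv; by rewrite -wv uw in nuv.
  - move=> w wv uw; rewrite ffunE (negbTE wv) Yo //.
    have wu : w != u by apply: contraNneq uw => ->.
    by rewrite (negbTE wu) X1o.
case E: (surplus X u) Xv1 m1 => [[|n]|n] // Xv1 _.
have [|Y [XY Yu Yb Yo]] := gu X; first by rewrite E.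
have {Yu} Yu : Y u = n.+1 by apply/eqP; rewrite -eqz_nat Yu E.
have Yv : Y v = X v by apply: Yo.
pose Z := transfer Y u v (n.+1)./2.
have XZ : reachable e X Z.
  by apply: reachable_trans XY _; apply: reachable_transfer => //; lia.
have Zu : Z u = odd n.+1 by rewrite ffunE eqxx Yu; lia.
have Zv : Z v = (X v + (n.+1)./2)%N by rewrite ffunE eqxx (negbTE vu') Yv.
have Zo w : w != u -> w != v -> Z w = Y w.
  by move=> wu wv; rewrite ffunE (negbTE wu) (negbTE wv).
have Zb w : branch u w -> w != u -> Z w = 0%N.
  move=> uw wu; rewrite Zo ?Yb //; by apply: contraTneq uw => ->.
have Zout w : w != v -> ~~ branch u w -> Z w = X w.
  move=> wv uw; rewrite Zo ?Yo //; by apply: contraNneq uw => ->.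
(* For odd surplus one pebble is left at [u]; [v] sends it a companion, and the
   pair moves up as a single pebble. *)
case o: (odd n.+1) in Zu Xv1; last first.
  exists Z; split=> //; first by rewrite Zv /net_up o; lia.
  by move=> w uw; have [->|/Zb->//] := eqVneq w u.
pose Z1 := move Z v u; pose Z2 := move Z1 u v.
have l1 : legal_move e Z v u.
  by rewrite /legal_move evu Zv /=; move: Xv1; rewrite /net_up o; lia.
have Z1u : Z1 u = 2%N by rewrite ffunE eqxx (negbTE uv) Zu.
have Z1v : Z1 v = (Z v - 2)%N by rewrite ffunE eqxx.
have l2 : legal_move e Z1 u v by rewrite /legal_move euv Z1u.
have Z2u : Z2 u = 0%N by rewrite ffunE eqxx Z1u.
have Z2v : Z2 v = (Z v - 1)%N.
  by rewrite ffunE eqxx (negbTE vu') Z1v; move: l1; rewrite /legal_move; lia.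
have Z2o w : w != u -> w != v -> Z2 w = Z w.
  by move=> wu wv; rewrite !ffunE (negbTE wu) (negbTE wv).
exists Z2; split.
- by apply: reachable_move l2; apply: reachable_move l1.
- by rewrite Z2v Zv; move: Xv1; rewrite /net_up o; lia.
- move=> w uw; have [->//|wu] := eqVneq w u.
  by rewrite Z2o ?Zb //; apply: contraTneq uw => ->.
- move=> w wv uw; rewrite Z2o ?Zout //; by apply: contraNneq uw => ->.
Qed.

(** The children are cleared one at a time.  One that can be cleared always
    exists: clearing a child with [net_up > 0] is always affordable, and if there
    is none, then what is on [v] covers the final surplus plus the cost of any
    single child. *)
Lemma gathers_children v : (forall u, child v u -> gathers u) -> gathers v.
Proof.
move=> gv X; move cX: #|[set u | child v u && nonempty X u]| => c.
elim: c X cX => [|c IH] X cX Xv1.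
  have X0 u : child v u -> nonempty X u = false.
    move=> vu; apply/negbTE/negP=> uX.
    by have := in_set0 u; rewrite -(cards0_eq cX) inE vu uX.
  exists X; split=> //; first exact: reachable_refl.
    rewrite surplusE big_pred0 ?addr0 // => u; apply/negbTE; rewrite negb_and.
    by case: (boolP (child v u)) => //= /X0 ->.
  move=> w vw wv; have [u vu uw] := branch_child vw wv.
  apply/eqP; rewrite -leqn0 leqNgt; apply: contraFN (X0 u vu) => Xw.
  by apply/existsP; exists w; rewrite Xw.
have [u /andP[vu uX] Xu1] : exists2 u, child v u && nonempty X u &
    1 <= (X v)%:Z + net_up (surplus X u).
  have /existsP[u /andP[uP Xu]] : [exists u, (child v u && nonempty X u) &&
      (1 <= (X v)%:Z + net_up (surplus X u))]; last by exists u.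
  apply: contraTT Xv1 => /existsPn none.
  have le0 u : child v u && nonempty X u -> net_up (surplus X u) <= - (X v)%:Z.
    by move=> uP; have := none u; rewrite uP /=; lia.
  have /card_gt0P[u] : (0 < #|[set u | child v u && nonempty X u]|)%N.
    by rewrite cX.
  rewrite inE => uP; rewrite surplusE (bigD1 u uP) /=.
  have := le0 u uP; set a := net_up _.
  have : \sum_(i | child v i && nonempty X i && (i != u))
           net_up (surplus X i) <= 0.
    by apply: sumr_le0 => i /andP[/le0]; lia.
  by set b := \sum_(_ | _) _; lia.
have [Y [XY Yv Yu Yo]] := clear_branch vu (gv u vu) Xu1.
have uY : nonempty Y u = false.
  by apply/negbTE/negP=> /existsP[w /andP[Yw /Yu]]; move: Yw => /[swap] ->.
have YX u' : child v u' -> u' != u -> forall w, branch u' w -> Y w = X w.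
  move=> vu' nu w u'w; apply: Yo.
    by apply: contraTneq u'w => ->; apply: child_notin_branch vu'.
  by apply: contraNN nu => uw; apply/eqP; apply: branch_child_inj vu' vu u'w uw.
have YE u' : (child v u' && nonempty Y u') =
             (child v u' && nonempty X u' && (u' != u)).
  have [->|nu] := eqVneq u' u; first by rewrite uY !andbF.
  rewrite andbT; case vu': (child v u') => //=.
  by apply: nonempty_local; apply: YX.
have Ys : surplus Y v = surplus X v.
  rewrite !surplusE [in RHS](bigD1 u) ?vu //= addrA -Yv; congr (_ + _).
  rewrite (eq_bigl _ _ YE); apply: eq_bigr => u' /andP[/andP[vu' _] nu].
  by congr net_up; apply: surplus_local; apply: YX.
have [|//|Z [YZ Zv Zb Zo]] := IH Y; last 1 first.
- exists Z; split=> //; first exact: reachable_trans XY YZ.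
    by rewrite Zv.
  move=> w vw; rewrite Zo // Yo //.
    by apply: contraNneq vw => ->; apply: branch_refl.
  by apply: contraNN vw => uw; apply: branch_trans (child_branch vu) uw.
- apply/eqP; rewrite -eqSS -cX.
  rewrite (cardsD1 u [set u | child v u && nonempty X u]) inE vu uX eqSS.
  by apply/eqP/eq_card => w; rewrite !inE YE andbC.
- by rewrite Ys.
Qed.

Lemma gathersT v : gathers v.
Proof.
have [n] := ubnP (#|T| - dep v); elim: n v => // n IH v lt.
apply: gathers_children => u vu; apply: IH.
have := dep_lt u; rewrite (child_dep vu); lia.
Qed.

Lemma surplus_stackable X : 1 <= surplus X s -> stackable e X.
Proof.
move=> Xs; have [Y [XY Ys Y0 _]] := gathersT Xs.
exists s, Y; split=> //; apply/setP=> w; rewrite !inE.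
have [->|ws] := eqVneq w s; last by rewrite Y0 ?branch_root.
by move: Xs; rewrite -Ys; case: (Y s).
Qed.

(** * The certificate left by a surplus that is not positive *)

(** Along the path from the root to [v] the value goes up by one at the vertices
    where [b] holds and down by one at the others; it starts at [#|T|], so that
    the predecessor is never taken at 0. *)
Fixpoint height_rec (b : pred T) (n : nat) (v : T) : nat :=
  if n is n'.+1 then
    let h := height_rec b n' (par v) in if b v then h.+1 else h.-1
  else #|T|.

Lemma exponents (b : pred T) : exists k : T -> nat, forall v, v != s ->
  if b v then k v = (k (par v)).+1 else k (par v) = (k v).+1.
Proof.
exists (fun v => height_rec b (dep v) v) => v vs.
have pos n w : (n + height_rec b n w >= #|T|)%N.
  by elim: n w => //= n IH w; have := IH (par w); case: (b w); lia.
rewrite (dep_par root_e vs) /=; case: (b v) => //.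
have := pos (dep (par v)) (par v); have := dep_lt v.
by rewrite (dep_par root_e vs); lia.
Qed.

(** Multiply the recursion of each vertex [v] by [2 ^ k v], where [2 ^ k] changes
    from parent to child by the slope of [net_up] that applies to the child, and
    add up: the surpluses of all vertices except the root cancel.  What remains of
    an edge comes from the constant terms of [net_up]: at most three times the
    smaller potential of its two ends, which is the sum of these potentials
    because one is twice the other. *)
Lemma surplus_certificate X : surplus X s <= 0 ->
  exists2 k : T -> nat,
    forall v, v != s -> k v = (k (par v)).+1 \/ k (par v) = (k v).+1 &
    (\sum_v X v * 2 ^ k v <=
      \sum_(u | (u != s) && nonempty X u) (2 ^ k u + 2 ^ k (par u)))%N.
Proof.
move=> Xs; have [k kP] := exponents (fun v => surplus X v <= 1).
exists k; first by move=> v /kP; case: ifP; [left|right].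
pose g v : int := (2 ^ k v)%N%:Z.
pose c u : int := if nonempty X u then g u + g (par u) else 0.
have edge u : u != s -> g u * surplus X u <=
    c u + (if nonempty X u then g (par u) * net_up (surplus X u) else 0).
  move=> us; rewrite /c; case: ifP => uX; last first.
    rewrite surplusE (_ : X u = 0%N) ?big_pred0 ?addr0 ?mulr0 //.
      move=> x; apply/negbTE/negP=> /andP[ux /existsP[w /andP[Xw xw]]].
      move/negbT/existsPn/(_ w)/negP: uX; apply; rewrite Xw.
      exact: branch_trans (child_branch ux) xw.
    apply/eqP; rewrite -leqn0 leqNgt; apply: contraFN uX => Xu.
    by apply/existsP; exists u; rewrite Xu branch_refl.
  have := kP u us; rewrite /g; case: ifP => Xu -> ; rewrite expnS.
  - set a := (2 ^ _)%N; have -> : net_up (surplus X u) = surplus X u *+ 2 - 3.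
      by case: (surplus X u) Xu => [[|[]]|].
    lia.
  - set a := (2 ^ _)%N; have : surplus X u <= net_up (surplus X u) *+ 2 + 3.
      by case: (surplus X u) Xu => [[|n]|n] //=; rewrite /net_up; lia.
    set m := surplus X u; set f := net_up m; nia.
have E : \sum_v g v * surplus X v = \sum_v g v * (X v)%:Z +
   \sum_(u | u != s)
     (if nonempty X u then g (par u) * net_up (surplus X u) else 0).
  rewrite (big_edges _ (fun u v =>
    if nonempty X u then g v * net_up (surplus X u) else 0)).
  rewrite -big_split /=; apply: eq_bigr => v _.
  by rewrite surplusE mulrDr big_distrr /= big_mkcondr.
have : \sum_(u | u != s) g u * surplus X u <= \sum_(u | u != s) c u +
  \sum_(u | u != s)
    (if nonempty X u then g (par u) * net_up (surplus X u) else 0).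
  by rewrite -big_split /=; apply: ler_sum => u /edge.
move: E; rewrite (bigD1 s) //=.
have : g s * surplus X s <= 0.
  by rewrite pmulr_rle0 // /g ltz_nat expn_gt0.
have -> : \sum_v g v * (X v)%:Z = (\sum_v X v * 2 ^ k v)%N%:Z.
  rewrite (big_morph Posz PoszD (erefl 0%:Z)); apply: eq_bigr => v _.
  by rewrite PoszM mulrC.
have -> : \sum_(u | u != s) c u = 
  (\sum_(u | (u != s) && nonempty X u) (2 ^ k u + 2 ^ k (par u)))%N%:Z.
  rewrite (big_morph Posz PoszD (erefl 0%:Z)) big_mkcondr.
  by apply: eq_bigr => u _; rewrite /c; case: ifP.
rewrite -lez_nat; set A := Posz _; set B := Posz _.
set S := \sum_(u | u != s) (if _ then _ else _); set R := \sum_(i | i != s) _.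
set m := g s * _; lia.
Qed.

Local Close Scope ring_scope.

(** The vertex [r] is one of least exponent; [D] stands for the distance from
    [r], of which only the bound on the growth of [k] matters.  After division by
    [2 ^ k r], a leaf with pebbles appears once on the right of the certificate,
    and one of its pebbles pays for it.  A leaf without pebbles does not appear
    there, unless it is the root [s]: this is why [s] must carry a pebble. *)
Lemma mass_le_estimate X k : (forall v, 0 < deg e v) -> 0 < X s ->
  (forall v, v != s -> k v = (k (par v)).+1 \/ k (par v) = (k v).+1) ->
  \sum_v X v * 2 ^ k v <=
    \sum_(u | (u != s) && nonempty X u) (2 ^ k u + 2 ^ k (par u)) ->
  exists r, forall D : T -> nat, (forall v, k v <= k r + D v) ->
  mass X <= \sum_(v | (v == r) || (1 < deg e v)) deg e v * 2 ^ D v + ell e r.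
Proof.
move=> deg_gt0 Xs kP cert.
have [r _ rmin] := arg_minnP k (isT : xpredT s).
exists r => D kD; pose h v := 2 ^ (k v - k r).
have hE v : 2 ^ k v = 2 ^ k r * h v by rewrite -expnD subnKC ?rmin.
have h_gt0 v : 0 < h v by rewrite expn_gt0.
(* Edges with no pebbles below them are left out at their lower end only: the
   bound needs this at leaves, and nowhere else. *)
pose c v := (v != s) && nonempty X v + #|[set u | child v u]|.
have {cert} cert : \sum_v X v * h v <= \sum_v c v * h v.
  rewrite -(leq_pmul2l (expn_gt0 2 (k r))) [X in X <= _]big_distrr /=.
  rewrite (eq_bigr (fun v => X v * 2 ^ k v)); last first.
    by move=> v _; rewrite (hE v) mulnCA.
  apply: leq_trans cert _.
  rewrite (eq_bigr (fun u => 2 ^ k r * (h u + h (par u)))); last first.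
    by move=> u _; rewrite mulnDr -!hE.
  rewrite -big_distrr leq_pmul2l ?expn_gt0 //= big_split /=.
  rewrite [X in _ <= X](eq_bigr (fun v => (v != s) && nonempty X v * h v +
    #|[set u | child v u]| * h v)); last by move=> v _; rewrite mulnDl.
  rewrite big_split -sum_par /=; apply: leq_add.
    by rewrite big_mkcond; apply: leq_sum => v _; case: andP; rewrite ?mul1n.
  by apply: leq_sum_subset => u /andP[].
pose Q v := (v == r) || (1 < deg e v).
have local v : X v + c v * h v <=
    X v * h v + (if Q v then deg e v * 2 ^ D v else 1).
  have Xh : X v <= X v * h v by rewrite leq_pmulr.
  case: ifP => Qv.
    apply: leq_add => //; apply: leq_mul.
      rewrite /c deg_children addnC leq_add2l; case: (v != s) => //=.
      by case: (nonempty X v).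
    by rewrite leq_exp2l // leq_subLR.
  have d1 : deg e v = 1.
    by have := negbT Qv; have := deg_gt0 v; rewrite /Q negb_or; lia.
  have c1 : c v <= (0 < X v).
    move: d1; rewrite deg_children /c; have [->|vs] := eqVneq v s.
      by rewrite Xs; lia.
    rewrite addn1 => -[/cards0_eq ch0]; rewrite ch0 cards0 addn0 /=.
    case: (boolP (nonempty X v)) => // /existsP[w /andP[Xw vw]].
    have [<-|wv] := eqVneq w v; first by rewrite Xw.
    have [u vu _] := branch_child vw wv.
    by have := in_set0 u; rewrite -ch0 inE vu.
  have := h_gt0 v; case: (X v) c1 Xh => [|x] /=; first by case: (c v).
  move=> c1 _ h1; have ch : c v * h v <= 1 * h v by rewrite leq_mul2r c1 orbT.
  by have := leq_pmulr x h1; rewrite mulSn; lia.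
have : \sum_v X v + \sum_v c v * h v <= \sum_v X v * h v +
    \sum_v (if Q v then deg e v * 2 ^ D v else 1).
  by rewrite -!big_split; apply: leq_sum.
have -> : \sum_v (if Q v then deg e v * 2 ^ D v else 1) =
    \sum_(v | Q v) deg e v * 2 ^ D v + ell e r.
  rewrite (bigID Q) /=; congr (_ + _); first by apply: eq_bigr => v ->.
  rewrite (eq_bigr (fun => 1)) => [|v /negbTE->//]; rewrite sum1_card.
  apply: eq_card => v; rewrite !inE unfold_in /Q negb_or.
  by have := deg_gt0 v; case: (deg e v) => [|[]].
move=> le; rewrite -(leq_add2r (\sum_v c v * h v)); apply: leq_trans le _.
by rewrite addnC leq_add2l.
Qed.

End Rooted.

(** * The two bounds *)

Lemma deg_gt0 (T : finType) (e : rel T) (v : T) :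
  is_tree e -> 2 <= #|T| -> 0 < deg e v.
Proof.
case=> _ _ conn_e _ T2.
have /existsP[w wv] : [exists w, w != v].
  rewrite -negb_forall; apply/negP=> /forallP vT.
  move: T2; rewrite ltnNge -(card1 v) => /negP; apply.
  by apply/subset_leq_card/subsetP => w _; exact: vT.
have [p] := connectP (conn_e v w).
case: p => [|x p] /= => [_ wv'|/andP[evx _ _]]; first by rewrite wv' eqxx in wv.
by apply/card_gt0P; exists x; rewrite inE.
Qed.

(** By the handshake identity the initial weight equals the whole budget. *)
Lemma far_config_unstackable (T : finType) (e : rel T) (r : T) :
  is_tree e -> 2 <= #|T| ->
  exists2 X : config T, mass X = (estimE e r).-1 & ~ stackable e X.
Proof.
move=> tree_e T2; have [par root_e] := tree_rooted r tree_e.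
have [[sym_e _] _ conn_e _] := tree_e.
pose Q v := (v == r) || (1 < deg e v).
pose N := \sum_(v | Q v) deg e v * 2 ^ gdist e r v.
have leafE v : v != r -> Q v = (deg e v != 1).
  rewrite /Q => /negbTE ->; have := deg_gt0 v tree_e T2.
  by case: (deg e v) => [|[]].
pose X : config T := [ffun v => if v == r then N else (deg e v == 1) : nat].
have sumX (F : T -> nat) : \sum_v X v * F v = N * F r + \sum_(v | ~~ Q v) F v.
  rewrite (bigD1 r) //= ffunE eqxx; congr (_ + _).
  rewrite big_mkcond [RHS]big_mkcond; apply: eq_bigr => v _; rewrite ffunE.
  have [->|vr] := eqVneq v r; first by rewrite /Q eqxx.
  by rewrite (leafE v vr) negbK; case: eqP; rewrite ?mul1n.
have wX : weight (gdist e r) X = 3 * \sum_(u | u != r) 2 ^ gdist e r (par u).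
  rewrite /weight sumX gdist0 // muln1.
  rewrite (eq_bigr (fun v => deg e v * 2 ^ gdist e r v)).
    have := sum_deg root_e sym_e (fun v => 2 ^ gdist e r v).
    rewrite (bigID Q) /= -/N => ->; rewrite big_distrr.
    apply: eq_bigr => u ur /=.
    by rewrite (dep_par root_e ur) expnS -mulSnr.
  move=> v; case: (eqVneq v r) => [->|vr]; first by rewrite /Q eqxx.
  by rewrite leafE // negbK => /eqP ->; rewrite mul1n.
exists X.
  rewrite /mass (eq_bigr (fun v => X v * 1)); last by move=> v _; rewrite muln1.
  rewrite sumX muln1 sum1_card /estimE /sigma /ell -/Q -/N add1n addSn /=.
  congr (_ + _); apply: eq_card => v; rewrite !inE.
  have [->|vr] := eqVneq v r; first by rewrite unfold_in /Q eqxx.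
  by rewrite unfold_in (leafE v vr) negbK.
apply: (budget_unstackable root_e); rewrite wX ?dvdn_mulr // leq_mul2l /=.
apply: leq_sum_subset => u ur; rewrite ur /=.
have [l ul /andP[lr /eqP d1]] :=
  branch_leaf root_e sym_e (gdist_lt conn_e r) ur.
by apply/existsP; exists l; rewrite ul andbT ffunE (negbTE lr) d1.
Qed.

Lemma heavy_stackable (T : finType) (e : rel T) (X : config T) :
  is_tree e -> 2 <= #|T| -> mass X = estim e -> stackable e X.
Proof.
move=> tree_e T2 massX; have [[sym_e _] T0 conn_e _] := tree_e.
have deg_gt0 v := deg_gt0 v tree_e T2.
have m0 : 0 < mass X.
  have /card_gt0P[v _] := T0.
  rewrite massX; apply: leq_trans (leq_bigmax v).
  by rewrite /estimE /sigma add1n addSn.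
have [s Xs] : exists s, 0 < X s.
  move: m0; rewrite lt0n sum_nat_eq0 negb_forall => /existsP[s].
  by rewrite /= -lt0n; exists s.
have [par root_e] := tree_rooted s tree_e.
have dep_lt := gdist_lt conn_e s.
have [Xs1|Xs0] :
    (1 <= surplus s par X s)%R \/ (surplus s par X s <= 0)%R by lia.
  exact: (surplus_stackable root_e sym_e dep_lt Xs1).
have [k kP cert] := surplus_certificate root_e dep_lt Xs0.
have [r rP] := mass_le_estimate root_e sym_e deg_gt0 Xs kP cert.
have kdist v : k v <= k r + gdist e r v.
  have [p [ep lp] <-] := gdistP conn_e r v; rewrite -{}lp.
  elim: p r ep {rP} => [|y p IH] x /=; first by rewrite addn0.
  case/andP=> exy /IH; have : k y <= (k x).+1.
    by case: (edge_par root_e exy) => -[/kP]; move=> + pE; rewrite pE; lia.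
  lia.
have := rP _ kdist; have : estimE e r <= mass X by rewrite massX leq_bigmax.
rewrite /estimE /sigma; lia.
Qed.

(** A configuration of mass [n + 1] with a legal move becomes one of mass [n].
    If it has none, it has at most one pebble per vertex; then removing a pebble
    leaves [n >= 2] vertices with one pebble each, again without legal moves, and
    this is not stackable. *)
Lemma all_stackableS (T : finType) (e : rel T) n : irreflexive e ->
  (forall v, 0 < deg e v) -> 2 <= n ->
  all_stackable e n -> all_stackable e n.+1.
Proof.
move=> irr_e deg_gt0 n2 nP X massX.
have [/existsP[u /existsP[v uv]]|none] :=
  boolP [exists u, exists v, legal_move e X u v].
  have [euv X2] := andP uv.
  have nuv : u != v by apply: contraTneq euv => ->; rewrite irr_e.
  have [|r [D [XD Dr]]] := nP (move X u v).
    have := sum_move (fun=> 1) nuv X2.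
    rewrite !(eq_bigr _ (fun w _ => muln1 _)) -!/(mass _) massX; lia.
  exists r, D; split=> //.
  apply: reachable_trans XD; apply: reachable_move uv; exact: reachable_refl.
have X1 u : X u <= 1.
  have /card_gt0P[v] := deg_gt0 u; rewrite inE leqNgt => euv.
  apply: contraNN none => X2; apply/existsP; exists u; apply/existsP; exists v.
  by rewrite /legal_move euv.
have [w Xw] : exists w, 0 < X w.
  have : mass X != 0 by rewrite massX.
  rewrite sum_nat_eq0 negb_forall => /existsP[w].
  by rewrite /= -lt0n; exists w.
pose Y : config T := [ffun v => X v - (v == w)].
have Y1 v : Y v <= 1 by rewrite ffunE; apply: leq_trans (X1 v); apply: leq_subr.
have massY : mass Y = n.
  move: massX; rewrite /mass (bigD1 w) //= => XE; rewrite (bigD1 w) //=.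
  rewrite ffunE eqxx (eq_bigr X) => [|v /negbTE vw].
    by move: Xw XE; case: (X w) => // x _; rewrite addSn subn1 => -[].
  by rewrite ffunE vw subn0.
have [r [D [YD Dr]]] := nP Y massY.
have {YD} DY : D = Y.
  elim: YD => // D' u v _ -> /andP[_ Y2].
  by have := Y1 u; rewrite leqNgt Y2.
rewrite DY in Dr.
have : mass Y <= 1.
  rewrite /mass (bigD1 r) //= big1 ?addn0 // => v vr.
  have := congr1 (fun A : {set T} => v \in A) Dr; rewrite !inE (negbTE vr).
  by case: (Y v).
by rewrite massY leqNgt n2.
Qed.

Theorem theorem1p1 (T : finType) (e : rel T) (tree_e : is_tree e)
  (card_T : 2 <= #|T|) : is_stack e (estim e).
Proof.
have d0 v := deg_gt0 v tree_e card_T.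
have [[_ irr_e] T0 _ _] := tree_e.
split.
- have /card_gt0P[r _] := T0; apply: leq_trans (leq_bigmax r).
  rewrite /estimE /sigma add1n addSn ltnS (bigD1 r) ?eqxx //=.
  apply: leq_trans (_ : deg e r * 2 ^ gdist e r r <= _); last by lia.
  by rewrite muln_gt0 d0 expn_gt0.
- by move=> X; apply: heavy_stackable.
- move=> t t2 tP; apply/bigmax_leqP=> r _; rewrite leqNgt; apply/negP=> lt.
  have [X massX []] := far_config_unstackable r tree_e card_T.
  suff: all_stackable e (mass X) by apply.
  have: t <= mass X by rewrite massX; lia.
  elim: (mass X) => [|n IH]; first by lia.
  rewrite leq_eqVlt => /predU1P[<-//|]; rewrite ltnS => /[dup] tn /IH.
  by apply: all_stackableS => //; apply: leq_trans tn.
Qed.
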